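(* Let $(X,\Vert\cdot\vert)$ be an $f$-Banach space, and let $K$ be an $f$-closed, $f$-bounded, convex and non-empty subset of $X$. If $T:K\to K$ is $f$-non-expansive, $(T-I)(K)=\{Tx-x:x\in K\}$ is an $f$-closed subset of $X$, and $f$-convergence implies $b$-convergence, then $T$ has a fixed point in $K$.
   Context: An asymmetric norm on a real vector space $X$ is a function $\Vert\cdot\vert:X\to\mathbb{R}$ such that for all $x,y\in X$ and $\lambda\ge 0$: $\Vert x\vert\ge 0$; $\Vert x\vert=\Vert -x\vert=0$ if and only if $x=0$; $\Vert\lambda x\vert=\lambda\Vert x\vert$; $\Vert x+y\vert\le\Vert x\vert+\Vert y\vert$. The pair $(X,\Vert\cdot\vert)$ is an asymmetric normed space, equipped with the asymmetric distance $d(x,y)=\Vert y-x\vert$. The forward topology $\tau^f$ is generated by the base of $f$-balls $B^f(x,r)=\{u: d(x,u)<r\}$, $x\in X$, $r>0$; ''$f$-closed'' means closed in $\tau^f$, and ''$f$-bounded'' means contained in some $f$-ball. A sequence $\{x_n\}$ $f$-converges to $x$ if $d(x,x_n)=\Vert x_n-x\vert\to 0$, and $b$-converges to $x$ if $d(x_n,x)=\Vert x-x_n\vert\to 0$. ''$f$-convergence implies $b$-convergence'' means that whenever $\{x_n\}$ $f$-converges to $x$, it also $b$-converges to $x$. A sequence $\{x_n\}$ is $f$-Cauchy if for all $\epsilon>0$ there is $N$ such that $d(x_n,x_m)<\epsilon$ whenever $m\ge n\ge N$; $X$ is $f$-Banach if every $f$-Cauchy sequence is $f$-convergent in $X$.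 A map $T:K\to K$ is $f$-non-expansive if $\Vert Ty-Tx\vert\le\Vert y-x\vert$ for all $x,y\in K$. $I$ denotes the identity map. *)

(* Defs.v *)
(* MathComp-Analysis *)
From HB Require Import structures.
From mathcomp Require Import all_boot all_order all_algebra.
From mathcomp Require Import all_classical all_reals all_analysis.

Set Implicit Arguments.
Unset Strict Implicit.
Unset Printing Implicit Defensive.

Import Order.TTheory GRing.Theory Num.Theory.
Import numFieldNormedType.Exports.

Local Open Scope classical_set_scope.
Local Open Scope ring_scope.

Record asymNorm (R : realType) (X : lmodType R) := AsymNorm {
  asymnorm :> X -> R ;
  asymnorm_ge0 : forall x, 0 <= asymnorm x ;
  asymnorm_eq0 : forall x,
    (asymnorm x = 0 /\ asymnorm (- x) = 0) <-> x = 0 ;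
  asymnormZ : forall (l : R) x, 0 <= l -> asymnorm (l *: x) = l * asymnorm x ;
  asymnormD : forall x y, asymnorm (x + y) <= asymnorm x + asymnorm y
}.

Definition asymdist (R : realType) (X : lmodType R) (N : asymNorm X)
  (x y : X) : R := N (y - x).

Definition fball (R : realType) (X : lmodType R) (N : asymNorm X)
  (x : X) (r : R) : set X := [set u | asymdist N x u < r].

(* An alias of X, so that the forward topology of N can be its canonical one. *)
Definition forward (R : realType) (X : lmodType R) (N : asymNorm X) : Type := X.

Section ForwardTopology.
Context (R : realType) (X : lmodType R) (N : asymNorm X).

HB.instance Definition _ := Choice.on (forward N).
HB.instance Definition _ := isPointed.Build (forward N) (0 : X).

Let radius_gt0 : set (forward N * R) := [set c | 0 < c.2].
Let fball_of (c : forward N * R) : set (forward N) := fball N c.1 c.2.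

Let fball_cover : \bigcup_(c in radius_gt0) fball_of c = setT.
Proof.
rewrite -subTset => x _; exists (x, 1); first exact: ltr01.
have N0 : N 0 = 0 by have [_ /(_ erefl)[]] := asymnorm_eq0 N 0.
by rewrite /fball_of /fball /asymdist /= subrr N0 ltr01.
Qed.

Let fball_join (c c' : forward N * R) (t : forward N) :
  radius_gt0 c -> radius_gt0 c' -> fball_of c t -> fball_of c' t ->
  exists k, [/\ radius_gt0 k, fball_of k t &
    fball_of k `<=` fball_of c `&` fball_of c'].
Proof.
rewrite /fball_of /fball /asymdist /radius_gt0 /= => _ _ ct c't.
have N0 : N 0 = 0 by have [_ /(_ erefl)[]] := asymnorm_eq0 N 0.
exists (t, Num.min (c.2 - N ((t : X) - c.1)) (c'.2 - N ((t : X) - c'.1))).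
split=> /=; first by rewrite lt_min !subr_gt0 ct c't.
  by rewrite subrr N0 lt_min !subr_gt0 ct c't.
move=> u /=; rewrite lt_min => /andP[uc uc'].
have tri (a : X) : N ((u : X) - a) <= N ((u : X) - t) + N ((t : X) - a).
  by rewrite -{1}(subrK (t : X) (u : X)) -addrA asymnormD.
by split; apply: (le_lt_trans (tri _)); rewrite -ltrBrDr.
Qed.

HB.instance Definition _ :=
  isBaseTopological.Build (forward N) fball_cover fball_join.

End ForwardTopology.

Definition forward_closed (R : realType) (X : lmodType R) (N : asymNorm X)
  (A : set X) : Prop := closed (A : set (forward N)).

Definition fbounded (R : realType) (X : lmodType R) (N : asymNorm X)
  (A : set X) : Prop := exists x r, 0 < r /\ A `<=` fball N x r.

Definition fcvg (R : realType) (X : lmodType R) (N : asymNorm X)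
  (u : nat -> X) (x : X) : Prop := asymdist N x (u n) @[n --> \oo] --> (0 : R).

Definition bcvg (R : realType) (X : lmodType R) (N : asymNorm X)
  (u : nat -> X) (x : X) : Prop := asymdist N (u n) x @[n --> \oo] --> (0 : R).

Definition fcvg_implies_bcvg (R : realType) (X : lmodType R)
  (N : asymNorm X) : Prop := forall u x, fcvg N u x -> bcvg N u x.

Definition fcauchy (R : realType) (X : lmodType R) (N : asymNorm X)
  (u : nat -> X) : Prop :=
  forall e : R, 0 < e -> exists M : nat, forall n m : nat,
    (M <= n)%N -> (n <= m)%N -> asymdist N (u n) (u m) < e.

Definition fbanach (R : realType) (X : lmodType R) (N : asymNorm X) : Prop :=
  forall u, fcauchy N u -> exists x, fcvg N u x.

Definition fnonexpansive (R : realType) (X : lmodType R) (N : asymNorm X)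
  (K : set X) (T : X -> X) : Prop :=
  forall x y, K x -> K y -> N (T y - T x) <= N (y - x).

(* Main.v *)
Require Import Defs.
From HB Require Import structures.
From mathcomp Require Import all_boot all_order all_algebra.
From mathcomp Require Import all_classical all_reals all_analysis.

Set Implicit Arguments.
Unset Strict Implicit.
Unset Printing Implicit Defensive.

Import Order.TTheory GRing.Theory Num.Theory.
Import numFieldNormedType.Exports.

Local Open Scope classical_set_scope.
Local Open Scope ring_scope.

(** The approximate fixed points of [T] come from contractions.  Fix [x0] in
[K]; for small [t] the map [x |-> t *: x0 + (1 - t) *: T x] sends the convex set
[K] to itself and contracts forward distances by [1 - t].  Its fixed point [x]
satisfies [T x - x = t *: (T x - x0)], and [N (T x - x0)] is bounded on [K], so
[N (T x - x)] is as small as desired: [0] lies in the forward closure of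
[(T - I)(K)].  This set being forward closed, it contains [0], that is, [T] has
a fixed point.

The contraction principle [contraction_fixed_point] is the usual Picard
iteration; its asymmetric feature is the uniqueness of the limit.  The iterates
forward converge both to their limit [x] and to the image of [x], but a forward
topology need not be Hausdorff.  Forward convergence implying backward
convergence makes both distances between two forward limits vanish
([fcvg_unique]), and only the vanishing of both separates points. *)

Section AsymmetricDistance.
Context (R : realType) (X : lmodType R) (N : asymNorm X).
Implicit Types (x y z : X) (u : nat -> X).

Lemma asymdistxx x : asymdist N x x = 0.
Proof.
by rewrite /asymdist subrr; have [_ /(_ erefl)[]] := asymnorm_eq0 N 0.
Qed.

Lemma asymdist_triangle y x z :
  asymdist N x z <= asymdist N x y + asymdist N y z.
Proof.
by rewrite /asymdist [leRHS]addrC -{1}(subrK y z) -addrA asymnormD.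
Qed.

Lemma asymdist_separated x y :
  asymdist N x y <= 0 -> asymdist N y x <= 0 -> x = y.
Proof.
rewrite /asymdist => xy yx; apply/esym/subr0_eq.
by apply/(asymnorm_eq0 N); split; apply/eqP;
  rewrite eq_le asymnorm_ge0 ?opprB andbT.
Qed.

Lemma forward_closed_approx (A : set X) x : forward_closed N A ->
  (forall e, 0 < e -> exists2 a, A a & asymdist N x a < e) -> A x.
Proof.
move=> clA xA; apply: (clA (x : forward N)) => B.
rewrite nbhsE => -[U [[D D_gt0 <-] [[c r] Dcr xc]] UB].
have /xA[a Aa xa] : 0 < r - asymdist N c x by rewrite subr_gt0.
exists a; split => //; apply: UB; exists (c, r) => //=.
by apply: le_lt_trans (asymdist_triangle x c a) _; rewrite addrC -ltrBrDr.
Qed.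

(** Each of the two distances between the limits is squeezed between [0] and a
forward distance to [u n] plus a backward distance from [u n]. *)
Lemma fcvg_unique u x y : fcvg_implies_bcvg N ->
  fcvg N u x -> fcvg N u y -> x = y.
Proof.
move=> f_b.
suff le0 a b : fcvg N u a -> fcvg N u b -> asymdist N a b <= 0.
  by move=> ux uy; apply: asymdist_separated; exact: le0.
move=> ua /f_b ub.
have uab : asymdist N a (u n) + asymdist N (u n) b @[n --> \oo] --> (0 : R).
  by rewrite -[X in _ --> X]addr0; exact: cvgD.
apply: (cvgr_to_ge uab); near=> n; exact: asymdist_triangle.
Unshelve. all: by end_near. Qed.

(** Bounding a step by a difference of powers rather than by a power makes the
bounds telescope, so that no geometric series is summed. *)
Lemma fcauchy_geometric u (C q : R) : 0 <= C -> 0 <= q < 1 ->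
  (forall n, asymdist N (u n) (u n.+1) <= C * (q ^+ n - q ^+ n.+1)) ->
  fcauchy N u.
Proof.
move=> C_ge0 /andP[q_ge0 q_lt1] step.
have dist_nm n k : asymdist N (u n) (u (n + k)%N) <= C * (q ^+ n - q ^+ (n + k)).
  elim: k => [|k IHk]; first by rewrite addn0 asymdistxx subrr mulr0.
  apply: le_trans (asymdist_triangle (u (n + k)%N) _ _) _.
  apply: le_trans (lerD IHk _) _; first by rewrite addnS; exact: step.
  by rewrite -mulrDr addnS addrA subrK.
have Cq : C * q ^+ n @[n --> \oo] --> (0 : R).
  rewrite -[X in _ --> X](mulr0 C); apply: cvgM; [exact: cvg_cst|];
    by apply: cvg_expr; rewrite ger0_norm.
move=> e e_gt0; have [M _ CqM] := cvgr_lt _ Cq e e_gt0.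
exists M => n m Mn nm; rewrite -(subnKC nm).
apply: le_lt_trans (dist_nm _ _) (le_lt_trans _ (CqM n Mn)).
by rewrite ler_wpM2l// gerBl exprn_ge0.
Qed.

Lemma contraction_fixed_point (K : set X) (S : {fun K >-> K}) (q : R) :
  fbanach N -> fcvg_implies_bcvg N -> forward_closed N K -> K !=set0 ->
  0 <= q < 1 ->
  (forall x y, K x -> K y -> asymdist N (S x) (S y) <= q * asymdist N x y) ->
  exists2 x, K x & S x = x.
Proof.
move=> banach f_b K_closed [x0 Kx0] /andP[q_ge0 q_lt1] contr.
pose u n := iter n S x0.
have Ku n : K (u n) by elim: n => //= n IHn; exact: funS.
have [x ux] : exists x, fcvg N u x.
  apply: banach; apply: (@fcauchy_geometric u (asymdist N x0 (S x0) / (1 - q)) q).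
  - by rewrite divr_ge0 ?asymnorm_ge0// subr_ge0 ltW.
  - by rewrite q_ge0.
  move=> n; rewrite exprS -{1}[q ^+ n]mul1r -mulrBl mulrA divfK; last first.
    by rewrite subr_eq0 eq_sym lt_eqF.
  elim: n => [|n IHn]; first by rewrite expr0 mulr1.
  apply: le_trans (contr _ _ (Ku n) (Ku n.+1)) _.
  by rewrite exprS mulrCA ler_wpM2l.
have Kx : K x.
  apply: forward_closed_approx K_closed _ => e e_gt0.
  have [M _ uM] := cvgr_lt _ ux e e_gt0.
  by exists (u M); [|exact: uM (leqnn M)].
exists x => //; apply: (@fcvg_unique (fun n => u n.+1)) => //; last first.
  by rewrite /fcvg (cvg_shiftS (fun n => asymdist N x (u n))).
have qux : q * asymdist N x (u n) @[n --> \oo] --> (0 : R).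
  by rewrite -[X in _ --> X](mulr0 q); exact: cvgM (cvg_cst _) ux.
apply: (squeeze_cvgr _ (cvg_cst 0) qux); near=> n.
by rewrite asymnorm_ge0 contr.
Unshelve. all: by end_near. Qed.

End AsymmetricDistance.

Theorem theorem23 (R : realType) (X : lmodType R) (N : asymNorm X)
    (X_banach : fbanach N)
    (K : set X)
    (K_closed : forward_closed N K)
    (K_bounded : fbounded N K)
    (K_convex : convex_set K)
    (K_neq0 : K !=set0)
    (T : {fun K >-> K})
    (T_nonexp : fnonexpansive N K T)
    (TI_closed : forward_closed N [set T x - x | x in K])
    (f_b : fcvg_implies_bcvg N) :
  exists2 x, K x & T x = x.
Proof.
have [x0 Kx0] := K_neq0; have [c [r [r_gt0 K_ball]]] := K_bounded.
pose M := asymdist N x0 c + r.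
have M_gt0 : 0 < M by rewrite ltr_wpDl ?asymnorm_ge0.
have TK_bounded x : K x -> asymdist N x0 (T x) <= M.
  move=> Kx; apply: le_trans (asymdist_triangle N c _ _) _.
  by rewrite lerD2l ltW//; apply: K_ball; exact: funS.
suff [x Kx /eqP] : [set T x - x | x in K] 0.
  by rewrite subr_eq0 => /eqP; exists x.
apply: forward_closed_approx TI_closed _ => e e_gt0.
(* This choice gives both [0 < t < 1] and [t * M < e]. *)
pose t := e / (M + e).
have Me_gt0 : 0 < M + e by exact: addr_gt0.
have t_gt0 : 0 < t by exact: divr_gt0.
have t_lt1 : t < 1 by rewrite ltr_pdivrMr// mul1r ltrDr.
pose S x := t *: x0 + (1 - t) *: T x.
have S_fun : set_fun K K S.
  move=> x Kx; apply/set_mem.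
  apply: (K_convex x0 (T x) (Itv01 (ltW t_gt0) (ltW t_lt1))); apply/mem_set => //.
  exact: funS.
have [|x y Kx Ky|x Kx Sx] :=
    @contraction_fixed_point _ _ N K (mkfun_fun S_fun) (1 - t)
      X_banach f_b K_closed K_neq0.
- by rewrite subr_ge0 ltW//= gtrBl.
- rewrite /asymdist /= /S opprD addrACA subrr add0r -scalerBr.
  rewrite asymnormZ ?subr_ge0 ?(ltW t_lt1)//.
  by rewrite ler_wpM2l ?subr_ge0 ?(ltW t_lt1)//; exact: T_nonexp.
exists (T x - x); first by exists x.
have -> : T x - x = t *: (T x - x0).
  have {2}<- : S x = x by [].
  rewrite /S scalerBl scale1r scalerBr opprD opprB addrCA.
  by rewrite [T x + _]addrCA subrr addr0 addrC.
rewrite /asymdist subr0 asymnormZ; last exact: ltW.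
apply: (le_lt_trans (y := t * M)); first by rewrite ler_pM2l//; exact: TK_bounded.
by rewrite /t mulrAC ltr_pdivrMr// ltr_pM2l// ltrDl.
Qed.
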